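(* (i) For every $r\ge 1$, every $2$-letter signed pattern $[\tau]_a\in E_2^r$ and every $n\ge 0$, $$|E_n^r([\tau]_a)|=\sum_{j=0}^n j!\,(r-1)^j\binom{n}{j}^2 .$$ (ii) For $d\ge 1$, consider the two-element sets $T$ of $2$-letter signed patterns with signs in $\{1,\dots,d\}$ (that is, $T\subseteq E_2^d$, $|T|=2$). The number of $d$-Wilf classes of such sets is $1$ if $d=1$, $4$ if $d=2$, and $6$ for every $d\ge 3$.
   Context: Let $S_n$ be the set of permutations of $\{1,\dots,n\}$ and $[r]=\{1,\dots,r\}$. A signed permutation is $[\alpha]_b=(\alpha_1^{(b_1)},\dots,\alpha_n^{(b_n)})$ with $\alpha=(\alpha_1,\dots,\alpha_n)\in S_n$ (the symbols) and $b=(b_1,\dots,b_n)\in[r]^n$ (the signs); $E_n^r$ is the set of all of them, so $|E_n^r|=n!\,r^n$. For $[\tau]_a\in E_k^r$ and $[\alpha]_b\in E_n^r$, $[\alpha]_b$ avoids $[\tau]_a$ if there are no indices $1\le i_1<\dots<i_k\le n$ such that $(\alpha_{i_1},\dots,\alpha_{i_k})$ is order-isomorphic to $\tau$ and $b_{i_j}=a_j$ for all $j=1,\dots,k$. For a set $T$ of signed patterns, $E_n^r(T)$ is the set of elements of $E_n^r$ avoiding every element of $T$; $E_n^r([\tau]_a)=E_n^r(\{[\tau]_a\})$. A $2$-letter signed pattern is an element of $E_2^r$. Two sets $T_1,T_2$ of signed patterns with signs in $\{1,\dots,d\}$ are in the same $d$-Wilf class if $|E_n^r(T_1)|=|E_n^r(T_2)|$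 for all $n\ge 0$ and all $r\ge d$ (where $E_2^d\subseteq E_2^r$ in the obvious way). Convention: $0^0=1$. *)

(* Defs.v *)
From mathcomp Require Import all_boot fingroup perm.
From mathcomp.classical Require Import boolp.

Set Implicit Arguments.
Unset Strict Implicit.
Unset Printing Implicit Defensive.

(* E_n^r: a permutation (the symbols) and a word (the signs). The sets
   {1, ..., n} and [r] are represented by 'I_n and 'I_r, so both symbols and
   signs are numbered from 0. *)
Definition signed_perm (r n : nat) : finType :=
  ('S_n * {ffun 'I_n -> 'I_r})%type.

Definition symbols r n (s : signed_perm r n) : 'S_n := s.1.
Definition signs r n (s : signed_perm r n) : {ffun 'I_n -> 'I_r} := s.2.

(* i lists the positions i_1 < ... < i_k of an occurrence of t in s. *)
Definition occurrence r k n (t : signed_perm r k) (s : signed_perm r n)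
    (i : {ffun 'I_k -> 'I_n}) : bool :=
  [&& [forall j1 : 'I_k, forall j2 : 'I_k, (j1 < j2) ==> (i j1 < i j2)],
      [forall j1 : 'I_k, forall j2 : 'I_k,
         (symbols s (i j1) < symbols s (i j2)) == (symbols t j1 < symbols t j2)]
    & [forall j : 'I_k, signs s (i j) == signs t j]].

Definition avoids r k n (s : signed_perm r n) (t : signed_perm r k) : bool :=
  ~~ [exists i : {ffun 'I_k -> 'I_n}, occurrence t s i].

Definition avoiders r k n (T : {set signed_perm r k}) :
    {set signed_perm r n} :=
  [set s | [forall t in T, avoids s t]].
Arguments avoiders {r k} n T.

(* The inclusion of E_k^d into E_k^r for d <= r. *)
Definition widen_signs d r (le_dr : d <= r) k (t : signed_perm d k) :
    signed_perm r k :=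
  (symbols t, [ffun j => widen_ord le_dr (signs t j)]).

Definition wilf_equiv d k (T1 T2 : {set signed_perm d k}) : Prop :=
  forall (n r : nat) (le_dr : d <= r),
    #|avoiders n (widen_signs le_dr (k:=k) @: T1)| =
    #|avoiders n (widen_signs le_dr (k:=k) @: T2)|.

(* The classes of wilf_equiv among the two-element subsets of E_2^d. The
   relation quantifies over all n and r, hence the classical `[< _ >]. *)
Definition wilf_classes_of_pairs (d : nat) : {set {set {set signed_perm d 2}}} :=
  equivalence_partition
    (fun T1 T2 : {set signed_perm d 2} => `[< wilf_equiv T1 T2 >])
    [set T : {set signed_perm d 2} | #|T| == 2].

(* Main.v *)
Require Import Defs.
From mathcomp Require Import all_boot fingroup perm.
From mathcomp.classical Require Import boolp.
From mathcomp Require Import zify.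

Set Implicit Arguments.
Unset Strict Implicit.
Unset Printing Implicit Defensive.

(** A signed permutation is read from left to right as a word of (symbol, sign)
    letters, so that counting avoiders means counting words in which every pair
    of an earlier and a later letter is admissible; this gives a recursion on
    the first letter.

    If the forbidden patterns are x y, for x in a set S of signs and a fixed
    target sign y, all in the orientation 12, the letters read so far matter
    only through a threshold: the symbols above the smallest S-letter can no
    longer carry y. Whether y belongs to S is irrelevant. For #|S| = 1 the
    recursion yields the sum of (i), for #|S| = 2 it yields
    n! (s^n + n s^(n-1)) with s = r - 1.

    Up to reversal, complement, inverse and renaming of signs there are 14 types
    of pairs of patterns. When the two patterns have no sign in common, split the
    word according to the signs of the first pattern: the two parts are
    independent up to a shuffle, so by the case of one pattern all these types
    are equivalent. The types {+aa,-aa}, {+ab,-ab}, {+aa,+ab}, {+ab,+ac} (where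
    + is 12 and - is 21) share the closed formula above. The remaining types
    are {+ab,+ba}, {+aa,-ab}, {+ab,+ca} and {+ab,-ac}. The values for n = 3
    separate the six classes except {+ab,+ba} and {+ab,-ac}, which n = 4
    separates; both values are polynomials in the number of signs that do not
    occur in the patterns. *)

(** * Words with pairwise constraints *)

Section Words.

Variable X : finType.
Implicit Types (R : rel X) (A D : pred X).

(** [A] holds the letters still allowed; reading a letter [x] restricts it by [R x]. The direct
    description is [wordsE]. *)
Fixpoint words R n A : nat :=
  if n is n'.+1 then \sum_(x | A x) words R n' (fun y => A y && R x y) else 1.

Lemma eq_words R n A A' : A =1 A' -> words R n A = words R n A'.
Proof.
elim: n A A' => //= n IHn A A' eqA.
rewrite (eq_bigl _ _ eqA); apply: eq_bigr => x _.
by apply: IHn => y; rewrite eqA.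
Qed.

Lemma eq_words_rel R R' n A :
  (forall x y, A x -> A y -> R x y = R' x y) -> words R n A = words R' n A.
Proof.
elim: n A => //= n IHn A eqR; apply: eq_bigr => x Ax.
rewrite (@eq_words _ _ _ (fun y => A y && R' x y)); last first.
  by move=> y; case Ay: (A y); rewrite //= eqR.
by apply: IHn => y z /andP[Ay _] /andP[Az _]; apply: eqR.
Qed.

Lemma card_tuple_cons n (P : pred (seq X)) :
  #|[set t : n.+1.-tuple X | P t]| =
  \sum_x #|[set t : n.-tuple X | P (x :: t)]|.
Proof.
rewrite -sum1_card (reindex (fun p : X * n.-tuple X => cons_tuple p.1 p.2)) /=.
  rewrite (eq_bigl (fun p : X * n.-tuple X => true && P (p.1 :: p.2)));
    last first.
    by move=> p; rewrite inE.
  rewrite -(pair_big_dep predT (fun x (t : n.-tuple X) => P (x :: t))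
              (fun _ _ => 1)) /=.
  by apply: eq_bigr => x _; rewrite -sum1_card; apply: eq_bigl => t; rewrite inE.
exists (fun t => (thead t, behead_tuple t)) => [[x t] _ | t _].
  by congr pair; apply: val_inj.
by case/tupleP: t => x t; apply: val_inj; rewrite /= theadE.
Qed.

Lemma wordsE R n A :
  words R n A = #|[set t : n.-tuple X | all A t && pairwise R t]|.
Proof.
elim: n A => [|n IHn] A /=.
  rewrite (eq_card (B := predT)) ?card_tuple // => t.
  by rewrite !inE tuple0.
rewrite (card_tuple_cons n (fun t => all A t && pairwise R t)) big_mkcond.
apply: eq_bigr => x _ /=; case Ax: (A x) => /=; last first.
  by apply/esym/eqP; rewrite cards_eq0; apply/eqP/setP => t; rewrite !inE.
rewrite IHn; apply: eq_card => t; rewrite !inE.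
by rewrite all_predI -!andbA; congr (_ && _).
Qed.

(** Pascal's rule. In [words_shuffle] the two sums on the right belong to a first letter inside and
    outside [D]. *)
Lemma binomial_convolutionS n (f g : nat -> nat) :
  \sum_(j < n.+2) 'C(n.+1, j) * (f j * g (n.+1 - j)) =
  \sum_(j < n.+1) 'C(n, j) * (f j.+1 * g (n - j)) +
  \sum_(j < n.+1) 'C(n, j) * (f j * g (n - j).+1).
Proof.
rewrite big_ord_recl [X in _ = _ + X]big_ord_recl /= !bin0 !subn0 !mul1n.
rewrite addnCA; congr (_ + _).
under eq_bigr => i _ do rewrite /bump /= add1n subSS binS mulnDl.
rewrite big_split /= addnC; congr (_ + _).
rewrite big_ord_recr /= bin_small // mul0n addn0.
by apply: eq_bigr => i _; rewrite /bump /= add1n -subSn ?subSS.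
Qed.

(** Letters inside and outside [D] never constrain each other, so a word is a choice of the places
    of the [D]-letters together with two independent words. *)
Lemma words_shuffle R n A D :
  (forall x y, A x -> A y -> D x != D y -> R x y) ->
  words R n A = \sum_(j < n.+1) 'C(n, j) *
     (words R j (fun x => A x && D x) * words R (n - j) (fun x => A x && ~~ D x)).
Proof.
elim: n A => [|n IHn] A cross; first by rewrite big_ord1.
rewrite (binomial_convolutionS n (fun j => words R j (fun x => A x && D x))
           (fun j => words R j (fun x => A x && ~~ D x))) /= (bigID D) /=.
have sub x y z : A y && R x y -> A z && R x z -> D y != D z -> R y z.
  by move=> /andP[Ay _] /andP[Az _]; apply: cross.
congr (_ + _).
- under eq_bigr => x _ do rewrite (IHn _ (sub x)).
  rewrite exchange_big /=; apply: eq_bigr => j _.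
  rewrite -big_distrr big_distrl /=; congr (_ * _).
  apply: eq_bigr => x /andP[Ax Dx]; congr (_ * _); apply: eq_words => y.
    by rewrite andbAC.
  case Ay: (A y); rewrite //=; case Dy: (D y); rewrite /= ?andbF // andbT.
  by apply: cross; rewrite // Dx Dy.
- under eq_bigr => x _ do rewrite (IHn _ (sub x)).
  rewrite exchange_big /=; apply: eq_bigr => j _.
  rewrite -big_distrr [in RHS]big_distrr /=; congr (_ * _).
  apply: eq_bigr => x /andP[Ax Dx]; congr (_ * _); apply: eq_words => y.
    case Ay: (A y); rewrite //=; case Dy: (D y); rewrite /= ?andbF // andbT.
    by apply: cross; rewrite // Dy (negPf Dx).
  by rewrite andbAC.
Qed.

End Words.

Section WeightedWords.

Variables (X : finType) (Y : eqType) (R : rel Y).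

(* Letters x of X with the same class g x in Y behave alike, so that it suffices to
   count words over Y in which a letter y has weight #|g^-1 y|. *)
Fixpoint lwords (wt : Y -> nat) n (l : seq Y) : nat :=
  if n is n'.+1 then
    \sum_(y <- l) wt y * lwords wt n' [seq z <- l | R y z]
  else 1.

Lemma words_lwords n (g : X -> Y) (l : seq Y) : uniq l ->
  words (relpre g R) n (fun x => g x \in l) =
  lwords (fun y => #|[pred x | g x == y]|) n l.
Proof.
elim: n l => //= n IHn l Ul.
under eq_bigr => x _.
  rewrite (@eq_words _ _ _ _ (fun z => g z \in [seq t <- l | R (g x) t])).
    rewrite IHn ?filter_uniq //; over.
  by move=> z; rewrite mem_filter andbC.
rewrite [RHS](eq_bigr (fun y => \sum_(x | g x == y)
   lwords (fun y => #|[pred x | g x == y]|) n [seq z <- l | R (g x) z])).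
  rewrite big_seq (exchange_big_dep (fun x => g x \in l)) /=.
    apply: eq_bigr => x gl.
    rewrite big_mkcond (bigD1_seq (g x)) //= gl eqxx big1 ?addn0 // => y.
    by rewrite eq_sym => /negPf->; rewrite andbF.
  by move=> y x yl /eqP->.
by move=> y _; rewrite -sum_nat_const; apply: eq_big => // x /eqP->.
Qed.

End WeightedWords.

(** * Two-letter patterns and the symmetries of signed permutations *)

(* A two-letter pattern: true for the pattern 12 and false for 21, followed by
   the signs of the first and of the second letter. *)
Definition pat (K : Type) : Type := (bool * K * K)%type.

Definition flip (K : Type) (p : pat K) : pat K := (~~ p.1.1, p.1.2, p.2).

Section Coloured.

Variable K : finType.
Implicit Types (F : pred (pat K)) (p q : pat K).

Definition avoids_all n F : pred ('S_n * {ffun 'I_n -> K}) := fun s =>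
  [forall i : 'I_n, forall j : 'I_n,
     (i < j) ==> ~~ F (s.1 i < s.1 j, s.2 i, s.2 j)].

Definition avoiding_count F n : nat := #|[set s | avoids_all (n:=n) F s]|.

Lemma avoids_allP n F (s : 'S_n * {ffun 'I_n -> K}) :
  reflect (forall i j : 'I_n, i < j -> ~~ F (s.1 i < s.1 j, s.2 i, s.2 j))
          (avoids_all F s).
Proof.
apply: (iffP forallP) => [H i j|H i]; first by have /forallP/(_ j)/implyP := H i.
by apply/forallP => j; apply/implyP/H.
Qed.

Lemma eq_avoiding_count n F F' : F =1 F' ->
  avoiding_count F n = avoiding_count F' n.
Proof.
move=> eqF; apply: eq_card => s; rewrite !inE.
by apply: eq_forallb => i; apply: eq_forallb => j; rewrite eqF.
Qed.

Lemma avoiding_count_reindex n F F'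
    (h : 'S_n * {ffun 'I_n -> K} -> 'S_n * {ffun 'I_n -> K}) :
  injective h -> (forall s, avoids_all F' s = avoids_all F (h s)) ->
    avoiding_count F' n = avoiding_count F n.
Proof.
move=> inj_h eqF; rewrite /avoiding_count -[RHS](card_preimset _ inj_h).
by apply: eq_card => s; rewrite !inE eqF.
Qed.

Definition rev_perm n : 'S_n := perm (@rev_ord_inj n).

Lemma rev_permK n : involutive (rev_perm n).
Proof. by move=> i; rewrite !permE rev_ordK. Qed.

Lemma rev_perm_lt n (i j : 'I_n) : (rev_perm n i < rev_perm n j) = (j < i).
Proof. by rewrite !permE /= ltn_sub2lE ?ltn_ord. Qed.

Lemma perm_lt_neg n (s : 'S_n) (i j : 'I_n) : i < j ->
  (s j < s i) = ~~ (s i < s j).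
Proof.
move=> ij; rewrite -leqNgt ltn_neqAle; case: eqP => //= /val_inj /perm_inj eqij.
by rewrite eqij ltnn in ij.
Qed.

Lemma avoiding_count_compl n F :
  avoiding_count (fun p => F (flip p)) n = avoiding_count F n.
Proof.
apply: (@avoiding_count_reindex _ _ _ (fun s => (s.1 * rev_perm n, s.2)%g)).
  apply: inv_inj => -[s c] /=; congr pair;
    by apply/permP => i; rewrite !permM rev_permK.
move=> [s c]; apply/avoids_allP/avoids_allP => /= H i j ij; have := H i j ij;
  by rewrite /= !permM rev_perm_lt /flip /= (perm_lt_neg s ij).
Qed.

Lemma avoiding_count_rev n F :
  avoiding_count (fun p => F (~~ p.1.1, p.2, p.1.2)) n = avoiding_count F n.
Proof.
apply: (@avoiding_count_reindex _ _ _
  (fun s => (rev_perm n * s.1, [ffun i => s.2 (rev_perm n i)])%g)).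
  apply: inv_inj => -[s c];
  by congr pair; [apply/permP | apply/ffunP] => i;
    rewrite ?permM ?ffunE rev_permK.
move=> [s c]; apply/avoids_allP/avoids_allP => /= H i j ij.
  have lt_ji : rev_perm n j < rev_perm n i by rewrite rev_perm_lt.
  by have := H _ _ lt_ji; rewrite !permM !ffunE (perm_lt_neg s lt_ji).
have lt_ji : rev_perm n j < rev_perm n i by rewrite rev_perm_lt.
by have := H _ _ lt_ji; rewrite /= !permM !ffunE !rev_permK (perm_lt_neg s ij).
Qed.

Lemma avoiding_count_rc n F :
  avoiding_count (fun p => F (p.1.1, p.2, p.1.2)) n = avoiding_count F n.
Proof.
rewrite -avoiding_count_rev -[RHS]avoiding_count_compl;
  apply: eq_avoiding_count => -[[o x] y].
by rewrite /flip /= .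
Qed.

(** The inverse lists the letters by symbol and carries each sign along: an increasing pair keeps
    its order, the letters of a decreasing pair trade places. *)
Lemma avoiding_count_inv n F :
  avoiding_count (fun p => F (p.1.1, if p.1.1 then p.1.2 else p.2,
                          if p.1.1 then p.2 else p.1.2)) n = avoiding_count F n.
Proof.
apply: (@avoiding_count_reindex _ _ _
  (fun s => (s.1^-1, [ffun i => s.2 ((s.1^-1)%g i)])%g)).
  apply: inv_inj => -[s c];
  congr pair; rewrite /= ?invgK //;
  by apply/ffunP => i; rewrite !ffunE ?permK ?permKV.
move=> [s c]; apply/avoids_allP/avoids_allP => /= H i j ij; rewrite /= ?ffunE.
  set i' := (s^-1)%g i; set j' := (s^-1)%g j.
  have si : s i' = i by rewrite permKV.
  have sj : s j' = j by rewrite permKV.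
  case: (ltngtP i' j') => [ij'|ji'|/val_inj e].
  - by have := H _ _ ij'; rewrite si sj ij.
  - by have := H _ _ ji'; rewrite si sj ltnNge (ltnW ij).
  - by move: ij; rewrite -si -sj e ltnn.
case: (ltngtP (s i) (s j)) => [sij|sji|/val_inj/perm_inj e].
- by have := H _ _ sij; rewrite /= !ffunE !permK ij.
- by have := H _ _ sji; rewrite /= !ffunE !permK ltnNge (ltnW ij).
- by move: ij; rewrite e ltnn.
Qed.

(** Distinctness of symbols is part of the constraint: [n] letters with distinct symbols in ['I_n]
    spell a permutation. *)
Definition compatible n F : rel ('I_n * K) := fun x y =>
  (x.1 != y.1) && ~~ F (x.1 < y.1, x.2, y.2).

Lemma pairwise_tuple (X : eqType) n (R : rel X) (t : n.-tuple X) :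
  reflect (forall i j : 'I_n, i < j -> R (tnth t i) (tnth t j)) (pairwise R t).
Proof.
case: n t => [|n] t; first by rewrite tuple0; constructor => -[].
have x0 := tnth t ord0.
apply: (iffP (pairwiseP x0)) => H.
  move=> i j ij; rewrite !(tnth_nth x0).
  by apply: H; rewrite ?inE ?size_tuple ?ltn_ord.
move=> i j; rewrite !inE size_tuple => lin ljn ij.
by have := H (Ordinal lin) (Ordinal ljn) ij; rewrite !(tnth_nth x0).
Qed.

(** A signed permutation is encoded injectively as its tuple of letters, and every compatible tuple
    arises so. The predicate [A] may tie signs to symbols, as the split by signs requires. *)
Lemma card_avoids_all n F (A : pred ('I_n * K)) :
  #|[set s | avoids_all F s && [forall i, A (s.1 i, s.2 i)]]| =
  words (compatible F) n A.
Proof.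
rewrite wordsE.
pose h (s : 'S_n * {ffun 'I_n -> K}) := [tuple (s.1 i, s.2 i) | i < n].
have inj_h : injective h.
  move=> [s c] [s' c'] e.
  congr pair; [apply/permP|apply/ffunP] => i;
  by have := congr1 (fun t => tnth t i) e; rewrite /h !tnth_mktuple => -[].
rewrite -(card_imset _ inj_h); apply: eq_card => t; rewrite [RHS]inE.
apply/imsetP/andP => [[[s c]] | [At Rt]].
  rewrite inE => /andP[/avoids_allP Fs /forallP As] ->; split.
    by apply/all_tnthP => i; rewrite tnth_mktuple.
  apply/pairwise_tuple => i j ij;
    rewrite !tnth_mktuple /compatible /= (Fs i j) //.
  by rewrite andbT (inj_eq perm_inj) neq_ltn ij.
move/pairwise_tuple: Rt => Rt.
have inj1 : injective (fun i => (tnth t i).1).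
  move=> i j e; case: (ltngtP i j) => [ij|ij|/val_inj //];
  by have := Rt _ _ ij; rewrite /compatible e eqxx.
exists (perm inj1, [ffun i => (tnth t i).2]).
  rewrite inE; apply/andP; split.
    apply/avoids_allP => i j ij; rewrite /= !permE !ffunE.
    by have /andP[_] := Rt _ _ ij.
  apply/forallP => i; rewrite /= permE ffunE.
  by move/all_tnthP: At => /(_ i); case: (tnth t i).
apply: eq_from_tnth => i; rewrite tnth_mktuple /= permE ffunE.
by case: (tnth t i).
Qed.

Lemma avoiding_countE n F :
  avoiding_count F n = words (compatible (n:=n) F) n predT.
Proof.
rewrite -(card_avoids_all F predT); apply: eq_card => s; rewrite !inE.
by rewrite (introT forallP) ?andbT.
Qed.

End Coloured.

(** * The threshold recursion *)

Section Threshold.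

Variables (I K : finType) (lt : rel I).
Hypotheses (lt_irr : irreflexive lt) (lt_trans : transitive lt)
  (lt_total : forall u v, u != v -> lt u v || lt v u).
Implicit Types (V T : {set I}).

(** The number of elements above [v] ranks [V] from the top, so it takes each value below [#|V|]
    exactly once. *)
Lemma big_rank V (f : nat -> nat) :
  \sum_(v in V) f #|[set u in V | lt v u]| = \sum_(k < #|V|) f k.
Proof.
pose rk v := #|[set u in V | lt v u]|.
have rk_lt v w : v \in V -> w \in V -> lt v w -> rk w < rk v.
  move=> Vv Vw vw; apply: proper_card; apply/properP; split.
    apply/subsetP => u; rewrite !inE => /andP[-> wu]; exact: lt_trans wu.
  by exists w; rewrite !inE ?Vw ?lt_irr.
have Urk : uniq [seq rk v | v <- enum V].
  rewrite map_inj_in_uniq ?enum_uniq // => v w; rewrite !mem_enum => Vv Vw e.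
  apply/eqP/negPn/negP => /lt_total/orP[] /rk_lt; rewrite e ltnn;
  by move=> H; have := H _ _; rewrite Vv Vw => /(_ isT isT).
rewrite -(big_mkord xpredT f) -big_enum /= -(big_map rk xpredT).
apply: perm_big; apply: uniq_perm; rewrite ?iota_uniq //.
have sub : {subset [seq rk v | v <- enum V] <= index_iota 0 #|V|}.
  move=> _ /mapP[v + ->]; rewrite mem_enum mem_index_iota /= => Vv.
  apply: proper_card; apply/properP; split;
    first by apply/subsetP => u /[!inE]/andP[].
  by exists v; rewrite // inE lt_irr andbF.
by have [|_ mem_eq] := uniq_min_size Urk sub;
  rewrite // size_map size_iota subn0 cardE.
Qed.

Variables (S C : {set K}) (y0 : K).
Hypotheses (sSC : S \subset C) (Cy0 : y0 \in C).

(** [lt] is an arbitrary strict total order, so that the orientations 12 and 21 are treated at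
    once. *)
Definition threshold_rel : rel (I * K) := fun x z =>
  (x.1 != z.1) && ~~ [&& lt x.1 z.1, x.2 \in S & z.2 == y0].

(** Here [q] signs lie in [S], [t] outside, and [s] differ from [y0]; [j] letters are still to be
    read, [n] symbols remain, and [m] of them are blocked for [y0]. The first letter has a blocked
    symbol, or a free symbol with sign outside [S], or a free symbol with sign in [S] and [k]
    symbols above it, which are the blocked ones afterwards. *)
Fixpoint threshold_count q t s j n m : nat :=
  if j is j'.+1 then
    m * s * threshold_count q t s j' n.-1 m.-1 +
    ((n - m) * t * threshold_count q t s j' n.-1 m +
     q * \sum_(m <= k < n) threshold_count q t s j' n.-1 k)
  else 1.

(** [T] is a top segment of [V], so its elements take the ranks below [#|T|]. *)
Lemma big_rank_from V T (f : nat -> nat) : T \subset V ->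
  (forall u v, u \in T -> v \in V -> lt u v -> v \in T) ->
  \sum_(v in V :\: T) f #|[set u in V | lt v u]| = \sum_(#|T| <= k < #|V|) f k.
Proof.
move=> sTV upT.
have rkT v : v \in V -> (v \in T) = (#|[set u in V | lt v u]| < #|T|).
  move=> Vv; apply/idP/idP => [Tv|].
    apply: proper_card; apply/properP; split.
      by apply/subsetP => u; rewrite inE => /andP[Vu vu]; apply: upT vu.
    by exists v; rewrite // inE lt_irr andbF.
  rewrite ltnNge; apply: contraNT => Tv; apply: subset_leq_card.
  apply/subsetP => u Tu; rewrite inE (subsetP sTV) //=.
  have uv : v != u by apply: contraNneq Tv => ->.
  case/orP: (lt_total uv) => // /(upT _ _ Tu Vv); by rewrite (negPf Tv).
have leTV := subset_leq_card sTV.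
rewrite (big_nat_widenl _ 0) //= big_mkord [RHS]big_mkcond /=.
rewrite -(big_rank V (fun k => if #|T| <= k then f k else 0)) -big_mkcondr /=.
by apply: eq_bigl => v; rewrite inE andbC; case Vv: (v \in V);
  rewrite //= rkT // -leqNgt.
Qed.

(* T consists of the symbols above the threshold, which cannot carry y0. A letter
   with symbol in V :\: T and sign in S moves the threshold to its symbol. *)
Lemma words_threshold j V T : T \subset V ->
  (forall u v, u \in T -> v \in V -> lt u v -> v \in T) ->
  words threshold_rel j
    (fun z => [&& z.1 \in V, z.2 \in C & (z.1 \in T) ==> (z.2 != y0)]) =
  threshold_count #|S| (#|C| - #|S|) #|C|.-1 j #|V| #|T|.
Proof.
elim: j V T => //= j IHj V T sTV upT.
pose cnt_j := threshold_count #|S| (#|C| - #|S|) #|C|.-1 j #|V|.-1.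
have step v c : v \in V -> c \in C -> (v \in T) ==> (c != y0) ->
  words threshold_rel j (fun z =>
    [&& z.1 \in V, z.2 \in C & (z.1 \in T) ==> (z.2 != y0)] &&
    threshold_rel (v, c) z) =
  cnt_j (if v \in T then #|T|.-1 else
         if c \in S then #|[set u in V | lt v u]| else #|T|).
- move=> Vv Cc Tvc.
  (* [T'] is the set of blocked symbols after this letter. If [v] is blocked, so is everything above
     it, and only [v] itself drops out. *)
  pose T' := if v \in T then T :\ v else
             if c \in S then [set u in V | lt v u] else T.
  have ltvT u : v \notin T -> u \in T -> lt v u.
    move=> Tv Tu; have uv : v != u by apply: contraNneq Tv => ->.
    by case/orP: (lt_total uv) => // /(upT _ _ Tu Vv); rewrite (negPf Tv).
  rewrite /cnt_j (cardsD1 v V) Vv add1n /=.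
  have -> : (if v \in T then #|T|.-1 else
             if c \in S then #|[set u in V | lt v u]| else #|T|) = #|T'|.
    by rewrite /T'; case: ifP => Tv; [rewrite (cardsD1 v T) Tv|case: ifP].
  rewrite -IHj.
  + apply: eq_words => -[u d] /=; rewrite /threshold_rel /= !inE [v == u]eq_sym.
    case Vu: (u \in V); rewrite ?andbF //=.
    case Cd: (d \in C); rewrite ?andbF //=.
    case: (eqVneq u v) => [->|uv] /=; rewrite ?andbF // /T'.
    case Tv: (v \in T).
      rewrite !inE uv /=; case Tu: (u \in T) => /=.
        by case: (d == y0) => //=; rewrite ?andbF.
      case: (boolP (lt v u)) => // /(upT _ _ Tv Vu); by rewrite Tu.
    case: ifP => Sc; rewrite ?inE ?Vu /=; last by rewrite andbF andbT.
    case Tu: (u \in T) => /=; first by rewrite ltvT ?Tv //= andbb.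
    by case: (lt v u) => //=; rewrite negbK.
  + rewrite /T'; case: ifP => [Tv|Tv]; first exact: setSD.
    case: ifP => _; apply/subsetP => u; rewrite !inE.
      by move=> /andP[-> vu]; rewrite andbT; apply: contraTneq vu => ->;
        rewrite lt_irr.
    by move=> Tu; rewrite (subsetP sTV) // andbT; apply: contraFneq Tv => <-.
  + move=> u w; rewrite /T' !inE; case: ifP => [Tv|Tv].
      by rewrite !inE => /andP[uv Tu] /andP[-> Vw] /(upT _ _ Tu Vw).
    case: ifP => _; last by move=> Tu /andP[_ Vw]; apply: upT.
    by rewrite !inE => /andP[Vu vu] /andP[_ ->] uw; apply: lt_trans uw.
rewrite (eq_bigl (fun x : I * K => (x.1 \in V) &&
           ((x.2 \in C) && ((x.1 \in T) ==> (x.2 != y0))))) //.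
rewrite (eq_bigr (fun x : I * K => cnt_j (if x.1 \in T then #|T|.-1 else
         if x.2 \in S then #|[set u in V | lt x.1 u]| else #|T|))); last first.
  by move=> [v c] /and3P[]; apply: step.
rewrite -(pair_big_dep (fun v => v \in V)
  (fun v c => (c \in C) && ((v \in T) ==> (c != y0)))
  (fun v c => cnt_j (if v \in T then #|T|.-1 else
         if c \in S then #|[set u in V | lt v u]| else #|T|))) /=.
rewrite (bigID (mem T)) /=; congr (_ + _).
  rewrite (eq_bigl (mem T)) => [|v]; last first.
    by rewrite andbC; case Tv: (v \in T); rewrite //= (subsetP sTV).
  rewrite -/(cnt_j _) -mulnA -sum_nat_const; apply: eq_bigr => v Tv /=.
  rewrite (Tv : v \in T).
  have -> : #|C|.-1 = #|C :\ y0| by rewrite (cardsD1 y0 C) Cy0.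
  rewrite -sum_nat_const; apply: eq_big => [c|//].
  by rewrite !inE andbC.
rewrite (eq_bigl (mem (V :\: T))) => [|v]; last by rewrite !inE andbC.
rewrite (eq_bigr (fun v => (#|C| - #|S|) * cnt_j #|T| +
                           #|S| * cnt_j #|[set u in V | lt v u]|)) /=.
  rewrite big_split /= sum_nat_const -big_distrr /= big_rank_from //.
  by rewrite cardsD (setIidPr sTV) mulnA.
move=> v; rewrite inE => /andP[Tv Vv]; rewrite (negPf Tv) addnC.
rewrite (bigID (mem S)) /=; congr (_ + _).
  rewrite -sum_nat_const; apply: eq_big => [c|c /andP[_ ->] //].
  by rewrite andbT andbC; case Sc: (c \in S); rewrite //= (subsetP sSC).
rewrite -[in #|C| - #|S|](setIidPr sSC) -cardsD -sum_nat_const.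
apply: eq_big => [c|c /andP[_ /negPf->] //].
by rewrite !inE andbT andbC.
Qed.

End Threshold.

(** * Closed forms *)

Lemma ffactnD n m k : n ^_ (m + k) = n ^_ m * (n - m) ^_ k.
Proof.
elim: k => [|k IHk]; first by rewrite addn0 ffactn0 muln1.
by rewrite addnS !ffactnSr IHk -mulnA subnDA.
Qed.

Section ClosedForms.

Variables (q t s : nat) (a : nat -> nat).
Hypotheses (a0 : a 0 = 1)
  (aS : forall n, a n.+1 = t * n.+1 * a n +
                           q * \sum_(k < n.+1) n ^_ k * s ^ k * a (n - k)).

(** When the word uses up all symbols, the [m] blocked ones interact with no other letter: they take
    [n ^_ m] choices of places with [s] signs each, and the rest is a word with nothing blocked. *)
Lemma threshold_countE n m : m <= n ->
  threshold_count q t s n n m = n ^_ m * s ^ m * a (n - m).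
Proof.
elim: n m => [|n IHn] m le_mn; first by rewrite leqn0 in le_mn;
  rewrite (eqP le_mn) a0.
(* The contribution of the first letters with an unblocked symbol. *)
have IH2 : m <= n -> (n.+1 - m) * t * threshold_count q t s n n m +
     q * \sum_(m <= k < n.+1) threshold_count q t s n n k =
     n ^_ m * s ^ m * a (n.+1 - m).
  move=> le_mn'; rewrite subSn // aS mulnDr IHn //; congr (_ + _); first by nia.
  rewrite -{1}[m]add0n big_addn subSn // big_mkord mulnCA; congr (q * _).
  rewrite big_distrr; apply: eq_bigr => k _ /=.
  have lk := ltn_ord k; rewrite IHn; last by lia.
  by rewrite [k + m]addnC ffactnD expnD subnDA; nia.
case: m le_mn IH2 => [|m] le_mn IH2.
  by rewrite [LHS]/= IH2 // !ffactn0; lia.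
rewrite [LHS]/= -/(threshold_count q t s) (IHn m) // subSS.
move: le_mn; rewrite ltnS leq_eqVlt => /predU1P[->|lt_mn].
  rewrite subnn big_geq // !mul0n muln0 !addn0 ffactSS expnS; nia.
by rewrite -subSS IH2 // subSS ffactSS ffactnSr expnS; nia.
Qed.

Lemma threshold_count0 n : threshold_count q t s n n 0 = a n.
Proof. by rewrite threshold_countE // ffactn0 expn0 subn0 !mul1n. Qed.

End ClosedForms.

(** For $s>0$ this is $n!\,s^n L_n(-1/s)$ with the Laguerre polynomial $L_n$. *)
Definition laguerre s n := \sum_(0 <= j < n.+1) j`! * s ^ j * 'C(n, j) ^ 2.

(** The recursion [aS] for [q = 1] and [t = s]. Pascal's rule and absorption turn the convolution
    into the sum with ['C(n.+1, j) * 'C(n, j)], which is also what [defL] leaves. *)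
Lemma laguerreS s n :
  laguerre s n.+1 = s * n.+1 * laguerre s n +
                    1 * \sum_(k < n.+1) n ^_ k * s ^ k * laguerre s (n - k).
Proof.
rewrite mul1n.
have defL m : laguerre s m.+1 = s * m.+1 * laguerre s m +
    \sum_(j < m.+1) j`! * s ^ j * ('C(m.+1, j) * 'C(m, j)).
  rewrite /laguerre !big_mkord.
  have -> : \sum_(j < m.+1) j`! * s ^ j * ('C(m.+1, j) * 'C(m, j)) =
            \sum_(j < m.+2) j`! * s ^ j * ('C(m.+1, j) * 'C(m, j)).
    by rewrite [RHS]big_ord_recr /= (@bin_small m m.+1) // !muln0 addn0.
  rewrite !(big_ord_recl m.+1) /= !bin0 addnCA; congr (_ + _).
  rewrite big_distrr -big_split; apply: eq_bigr => i _ /=.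
  rewrite /bump add1n factS expnS -mulnn; 
  have := congr1 (muln (i`! * s * s ^ i * 'C(m, i))) (mul_bin_diag m.+1 i).
  by rewrite /= binS; nia.
have -> : \sum_(k < n.+1) n ^_ k * s ^ k * laguerre s (n - k) =
          \sum_(j < n.+1) j`! * s ^ j * ('C(n.+1, j) * 'C(n, j)).
  elim: n => [|n IHn].
    by rewrite !big_ord1 /laguerre big_nat1.
  rewrite big_ord_recl ffactn0 expn0 !mul1n subn0.
  under eq_bigr => k _ do rewrite /= /bump leq0n add1n ffactSS expnS subSS.
  rewrite (eq_bigr (fun k : 'I_n.+1 =>
    n.+1 * s * (n ^_ k * s ^ k * laguerre s (n - k))));
    last by move=> k _; nia.
  rewrite -big_distrr /= IHn /laguerre big_mkord !(big_ord_recl n.+1) /= !bin0.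
  rewrite -addnA; congr (_ + _).
  rewrite big_distrr -big_split; apply: eq_bigr => i _ /=.
  rewrite /bump add1n factS expnS -mulnn; 
  have := congr1 (muln (i`! * s * s ^ i * 'C(n.+1, i))) (mul_bin_diag n.+1 i).
  by rewrite /= (binS n.+1); nia.
by rewrite defL.
Qed.

Definition two_letter_count s n := n`! * (s ^ n + n * s ^ n.-1).

(** The recursion [aS] for [q = 2] and [t = s.-1]. The convolution has its own closed form, by
    induction: without the term [k = 0] it is a multiple of the preceding convolution. *)
Lemma two_letter_countS s n : 0 < s ->
  two_letter_count s n.+1 = s.-1 * n.+1 * two_letter_count s n +
             2 * \sum_(k < n.+1) n ^_ k * s ^ k * two_letter_count s (n - k).
Proof.
move=> s_gt0.
have -> : 2 * \sum_(k < n.+1) n ^_ k * s ^ k * two_letter_count s (n - k) =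
          n.+1`! * (2 * s ^ n + n * s ^ n.-1).
  elim: n => [|n IHn].
    by rewrite big_ord1 /two_letter_count /= fact0 expn0.
  rewrite big_ord_recl mulnDr ffactn0 expn0 !mul1n subn0.
  have -> : 2 * \sum_(i < n.+1) n.+1 ^_ (bump 0 i) * s ^ (bump 0 i) *
             two_letter_count s (n.+1 - bump 0 i) =
     n.+1 * s * (2 * \sum_(k < n.+1) n ^_ k * s ^ k * two_letter_count s (n - k)).
    rewrite [RHS]mulnCA [in RHS]big_distrr; congr (2 * _);
      apply: eq_bigr => k _ /=.
    by rewrite /bump add1n ffactSS expnS subSS; nia.
  rewrite IHn /two_letter_count !factS /= expnS; case: n {IHn} => [|n] /=.
    by rewrite !fact0 !expn0; nia.
  by rewrite expnS; nia.
rewrite /two_letter_count factS /= expnS; case: n => [|n] /=.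
  by rewrite fact0 !expn0; nia.
rewrite expnS; case: s s_gt0 => // s _; rewrite [s.+1.-1]/=; nia.
Qed.

(** * Evaluation for single patterns and for two of the classes *)

Section Evaluations.

Variable K : finType.
Implicit Types (F : pred (pat K)) (p q : pat K) (C S : {set K}) (o : bool).

(** The orientation 21 is handled by reversing the order of the symbols; no symbol is blocked at the
    start. *)
Lemma words_pattern n o S C (y : K) j (V : {set 'I_n}) :
  S \subset C -> y \in C ->
  words (compatible (n:=n) (fun p => [&& p.1.1 == o, p.1.2 \in S & p.2 == y])) j
    (fun x => (x.1 \in V) && (x.2 \in C)) =
  threshold_count #|S| (#|C| - #|S|) #|C|.-1 j #|V| 0.
Proof.
move=> sSC Cy; pose lt (u v : 'I_n) := if o then u < v else v < u.
have lt_irr : irreflexive lt by move=> u; rewrite /lt ltnn if_same.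
have lt_trans : transitive lt.
  by move=> v u w; rewrite /lt; case: (o) => [|/[swap]]; apply: ltn_trans.
have lt_total u v : u != v -> lt u v || lt v u.
  by rewrite /lt -(inj_eq val_inj) neq_ltn; case: (o); rewrite // orbC.
have := words_threshold lt_irr lt_trans lt_total sSC Cy j (sub0set V).
rewrite cards0 => <-; last by move=> u v; rewrite inE.
rewrite (@eq_words _ _ _ _ (fun z : 'I_n * K =>
    [&& z.1 \in V, z.2 \in C & (z.1 \in set0) ==> (z.2 != y)])); last first.
  by move=> z; rewrite inE andbT.
apply: eq_words_rel => x z _ _; rewrite /compatible /threshold_rel /=.
case: eqVneq => //= xz; congr (~~ (_ && _)).
rewrite /lt; case: (o); first exact: eqb_id.
by rewrite eqbF_neg -leqNgt leq_eqVlt eq_sym (inj_eq val_inj) (negPf xz).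
Qed.

Lemma avoiding_count_pattern n o S (y : K) :
  avoiding_count (fun p => [&& p.1.1 == o, p.1.2 \in S & p.2 == y]) n =
  threshold_count #|S| (#|K| - #|S|) #|K|.-1 n n 0.
Proof.
rewrite avoiding_countE.
have := words_pattern o n [set: 'I_n] (subsetT S) (in_setT y).
rewrite !cardsT card_ord => <-.
by apply: eq_words => z; rewrite !inE.
Qed.

(** With one sign in [S], equal to [y] or not, the parameters are [q = 1] and [t = s = #|K|.-1], as
    in [laguerreS]. *)
Lemma avoiding_count_pred1 n p : avoiding_count (pred1 p) n = laguerre #|K|.-1 n.
Proof.
case: p => [[o x] y]; pose a := laguerre #|K|.-1.
rewrite (@eq_avoiding_count _ _ _ (fun p =>
  [&& p.1.1 == o, p.1.2 \in [set x] & p.2 == y])).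
  rewrite avoiding_count_pattern cards1 subn1
    (threshold_count0 (a := laguerre #|K|.-1)) //.
    by rewrite /laguerre big_nat1.
  exact: laguerreS.
by move=> [[o' x'] y']; rewrite /= inE !xpair_eqE andbA.
Qed.

Lemma avoiding_count_same_target n o (x z y : K) : x != z ->
  avoiding_count (pred2 (o, x, y) (o, z, y)) n = two_letter_count #|K|.-1 n.
Proof.
move=> xz.
have K_gt1 : 1 < #|K|.
  by rewrite -cardsT (leq_trans _ (subset_leq_card (subsetT [set x; z]))) //
     cards2 xz.
rewrite (@eq_avoiding_count _ _ _ (fun p =>
  [&& p.1.1 == o, p.1.2 \in [set x; z] & p.2 == y])).
  rewrite avoiding_count_pattern cards2 xz
    (threshold_count0 (a := two_letter_count #|K|.-1)) //.
  have -> : #|K| - 2 = #|K|.-1.-1 by lia.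
  by move=> m; apply: two_letter_countS; lia.
move=> [[o' x'] y']; rewrite /= !inE !xpair_eqE.
by case: (o' == o); case: (x' == x); case: (x' == z); case: (y' == y).
Qed.

Lemma words_pattern1 n F p C j (V : {set 'I_n}) :
  p.1.2 \in C -> p.2 \in C ->
  (forall o x y, x \in C -> y \in C -> F (o, x, y) = ((o, x, y) == p)) ->
  words (compatible (n:=n) F) j (fun x => (x.1 \in V) && (x.2 \in C)) =
  threshold_count 1 #|C|.-1 #|C|.-1 j #|V| 0.
Proof.
move=> Cp1 Cp2 eqF; rewrite -subn1 -{1 2}(cards1 p.1.2) subn1.
rewrite -(words_pattern p.1.1 j V (_ : [set p.1.2] \subset C) Cp2) ?sub1set //.
apply: eq_words_rel => x y /andP[_ Cx] /andP[_ Cy].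
rewrite /compatible eqF // inE; congr (_ && ~~ _).
by case: p {Cp1 Cp2 eqF} => [[o a] b]; rewrite !xpair_eqE -andbA.
Qed.

(* V is the set of the symbols whose signs belong to the first of two parts, of
   sizes c and d, of the set of signs. *)
Definition disjoint_count n c d :=
  \sum_(V : {set 'I_n}) \sum_(j < n.+1) 'C(n, j) *
    (threshold_count 1 c.-1 c.-1 j #|V| 0 *
     threshold_count 1 d.-1 d.-1 (n - j) #|~: V| 0).

(** Once the set [V] of symbols with signs in [C] is fixed, letters with signs inside and outside
    [C] have different symbols and form neither pattern, so the word is a shuffle of two parts with
    one pattern each. Only the sizes of [C] and its complement matter. *)
Lemma avoiding_count_split n C p q :
  p.1.2 \in C -> p.2 \in C -> q.1.2 \notin C -> q.2 \notin C ->
  avoiding_count (pred2 p q) n = disjoint_count n #|C| #|~: C|.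
Proof.
move=> Cp1 Cp2 Cq1 Cq2.
pose colour_values (s : 'S_n * {ffun 'I_n -> K}) : {set 'I_n} :=
  [set s.1 i | i in [set i | s.2 i \in C]].
rewrite /avoiding_count -sum1_card (partition_big colour_values predT) //=.
apply: eq_bigr => V _.
pose A (x : 'I_n * K) := (x.1 \in V) == (x.2 \in C).
transitivity (words (compatible (n:=n) (pred2 p q)) n A).
  rewrite -card_avoids_all -sum1_card; apply: eq_bigl => s; rewrite !inE.
  congr (_ && _); apply/eqP/forallP => [eqV i|As].
    by rewrite /A /= -eqV mem_imset ?inE //; apply: perm_inj.
  apply/setP => v; rewrite -(permKV s.1 v) mem_imset ?inE; last exact: perm_inj.
  by have /eqP<- := As ((s.1^-1)%g v).
rewrite (@words_shuffle _ _ _ _ (fun x => x.2 \in C)); last first.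
  move=> [u a] [v b]; rewrite /A /compatible /= => /eqP Vu /eqP Vv Cab.
  apply/andP; split; first by apply: contraNneq Cab => e; rewrite -Vu -Vv e.
  apply/negP => /orP[] /eqP e; move: Cab.
    by move: Cp1 Cp2; rewrite -e /= => -> ->.
  by move: Cq1 Cq2; rewrite -e /= => /negPf-> /negPf->.
apply: eq_bigr => j _; congr (_ * (_ * _)).
- rewrite -(@words_pattern1 _ (pred2 p q) _ _ j V Cp1 Cp2); last first.
    move=> o x y Cx Cy; rewrite /= orbC (_ : _ == q = false) //.
    by apply: contraNF Cq2 => /eqP<-.
  by apply: eq_words => x; rewrite /A; case: (x.2 \in C);
    rewrite ?andbF ?eqb_id ?andbT.
- rewrite -(@words_pattern1 _ (pred2 p q) q _ (n - j) (~: V)) ?inE //; last first.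
    move=> o x y; rewrite !inE => Cx Cy; rewrite /= (_ : _ == p = false) //.
    by apply: contraNF Cy => /eqP e; move: Cp2; rewrite -e.
  apply: eq_words => x; rewrite /A !inE.
  by case: (x.2 \in C); rewrite ?andbF ?eqbF_neg ?andbT.
Qed.

Definition disjoint_colours p q :=
  [&& p.1.2 != q.1.2, p.1.2 != q.2, p.2 != q.1.2 & p.2 != q.2].

(** Splitting along [[set a; b]] shows that the pair counts like {+aa,+cc}; splitting the latter
    along [[set a]] gives sizes common to all pairs. *)
Lemma avoiding_count_disjoint n p q : disjoint_colours p q ->
  avoiding_count (pred2 p q) n = disjoint_count n 1 #|K|.-1.
Proof.
have cnt1 o a q' : a != q'.1.2 -> a != q'.2 ->
    avoiding_count (pred2 (o, a, a) q') n = disjoint_count n 1 #|K|.-1.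
  move=> n1 n2; rewrite (@avoiding_count_split _ [set a]) ?inE
    ?eqxx // 1?eq_sym //.
  by rewrite cards1 cardsC1.
case: p q => [[o a] b] [[o' c] d] /and4P /= [ac ad bc bd].
have split2 : avoiding_count (pred2 (o, a, b) (o', c, d)) n =
              avoiding_count (pred2 (true, a, a) (true, c, c)) n.
  by rewrite !(@avoiding_count_split _ [set a; b]) ?inE ?eqxx ?orbT //=
     negb_or ![_ == a]eq_sym
     ![_ == b]eq_sym ?ac ?ad ?bc ?bd.
by rewrite split2 cnt1.
Qed.

Lemma words_free n j (F : pred (pat K)) (V : {set 'I_n}) C :
  {in C &, forall x y o, ~~ F (o, x, y)} ->
  words (compatible (n:=n) F) j (fun x => (x.1 \in V) && (x.2 \in C)) =
  #|V| ^_ j * #|C| ^ j.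
Proof.
move=> FC; elim: j V => //= j IHj V.
rewrite (eq_bigr (fun=> #|V|.-1 ^_ j * #|C| ^ j)) => [|[v c] /andP[/= Vv Cc]].
  rewrite -(pair_big_dep (mem V) (fun _ => mem C) (fun _ _ =>
    #|V|.-1 ^_ j * #|C| ^ j)).
  rewrite (eq_bigr (fun=> #|C| * (#|V|.-1 ^_ j * #|C| ^ j))) => [|v _].
    transitivity (#|V| * (#|C| * (#|V|.-1 ^_ j * #|C| ^ j)));
      first exact: sum_nat_const.
    by rewrite ffactnS expnS -mulnA; congr (_ * _); rewrite mulnCA.
  exact: sum_nat_const.
have -> : #|V|.-1 = #|V :\ v| by rewrite (cardsD1 v V) Vv.
rewrite -IHj; apply: eq_words => -[u d];
  rewrite /compatible /= !inE [v == u]eq_sym.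
case Cd: (d \in C); rewrite ?andbF //= FC // !andbT andbC.
by [].
Qed.

(** Both orientations together say that the sign [y] never follows the sign [x]: after the first
    [x], the later letters only have to avoid the sign [y]. *)
Lemma avoiding_count_both_orders n (x y : K) :
  avoiding_count (pred2 (true, x, y) (false, x, y)) n =
    two_letter_count #|K|.-1 n.
Proof.
rewrite avoiding_countE; set R := compatible _.
have key j (V : {set 'I_n}) : words R j (fun z => z.1 \in V) =
   #|V| ^_ j * #|K|.-1 ^ j + j * #|V| ^_ j * #|K|.-1 ^ j.-1.
  elim: j V => [|j IHj] V; first by rewrite ffactn0 expn0.
  rewrite [LHS]/= (eq_bigr (fun z : 'I_n * K => if z.2 == x then
      #|V|.-1 ^_ j * #|K|.-1 ^ j else
      #|V|.-1 ^_ j * #|K|.-1 ^ j + j * #|V|.-1 ^_ j * #|K|.-1 ^ j.-1)).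
    rewrite (eq_bigl (fun z : 'I_n * K => (z.1 \in V) && predT z.2)); last first.
      by move=> z; rewrite andbT.
    set a := _ * _; set b := a + _.
    rewrite -(pair_big_dep (mem V) (fun=> predT) (fun _ c =>
      if c == x then a else b)).
    have sumK : \sum_c (if c == x then a else b) = a + #|K|.-1 * b.
      rewrite (bigD1 x) //= eqxx -(cardsC1 x) -sum_nat_const; congr (_ + _).
      by apply: eq_big => [c|c /negPf->]; rewrite ?inE.
    transitivity (#|V| * (a + #|K|.-1 * b)).
      by rewrite -sumK -sum_nat_const; apply: eq_bigl.
    rewrite ffactnS expnS /b /a; move: (#|V|) (#|K|.-1) => v k.
    case: j {IHj a b sumK} => [|j]; rewrite ?ffactn0 ?expn0 ?expnS /=; nia.
  move=> [v c] /= Vv; have -> : #|V|.-1 = #|V :\ v| by rewrite (cardsD1 v V) Vv.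
  case: eqVneq => [->|cx].
    rewrite -(cardsC1 y) -(@words_free _ _ (pred2 (true, x, y) (false, x, y))).
      apply: eq_words => -[u d];
        rewrite /R /compatible !inE /= !xpair_eqE eqxx /=.
      by rewrite [v == u]eq_sym; case: (v < u); case: (d == y);
        rewrite //= ?andbT ?andbF // andbC.
    by move=> a b _; rewrite !inE => /negPf by_ o;
      rewrite /= !xpair_eqE by_ !andbF.
  rewrite -IHj; apply: eq_words => -[u d];
    rewrite /R /compatible !inE /= !xpair_eqE.
  by rewrite (negPf cx) !andbF /= andbT andbC eq_sym.
have := key n [set: 'I_n];
  rewrite cardsT card_ord ffactnn /two_letter_count mulnDr.
by rewrite -mulnA mulnCA => <-; apply: eq_words => z; rewrite in_setT.
Qed.

End Evaluations.

(** * Counting with a symbolic number of further signs *)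

(* Signs are coded by numbers: those below c are single signs, while c stands for
   k further signs which do not occur in the patterns. *)
Definition slot_weight c k (y : nat * nat) : nat := if y.2 < c then 1 else k.

Definition slot_compatible (ps : seq (pat nat)) : rel (nat * nat) := fun x y =>
  (x.1 != y.1) && ((x.1 < y.1, x.2, y.2) \notin ps).

Definition slots n c : seq (nat * nat) :=
  [seq (v, i) | v <- iota 0 n, i <- iota 0 c.+1].

Definition code_count c ps k n : nat :=
  lwords (slot_compatible ps) (slot_weight c k) n (slots n c).

Definition decode (K : Type) (x0 : K) (cs : seq K) (p : pat nat) : pat K :=
  (p.1.1, nth x0 cs p.1.2, nth x0 cs p.2).

Definition coded c : pred (pat nat) := fun p => (p.1.2 < c) && (p.2 < c).

Lemma eq_lwords (Y : eqType) (R : rel Y) (w w' : Y -> nat) n (l : seq Y) :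
  {in l, w =1 w'} -> lwords R w n l = lwords R w' n l.
Proof.
elim: n l => //= n IHn l eqw; apply: eq_big_seq => y ly.
rewrite eqw // IHn // => z; rewrite mem_filter => /andP[_]; exact: eqw.
Qed.

(** A sign is coded by its index in [cs]. All signs outside [cs] get the index [size cs], a class of
    weight [#|K| - size cs]. *)
Lemma avoiding_count_code (K : finType) n (x0 : K) (cs : seq K)
    (ps : seq (pat nat)) :
  uniq cs -> all (coded (size cs)) ps ->
  avoiding_count (fun p => p \in map (decode x0 cs) ps) n =
  code_count (size cs) ps (#|K| - size cs) n.
Proof.
move=> Ucs cps; rewrite avoiding_countE.
pose g (x : 'I_n * K) : nat * nat := (x.1 : nat, index x.2 cs).
have Ul : uniq (slots n (size cs)).
  by apply: allpairs_uniq; rewrite ?iota_uniq // => -[a b] [a' b'] _ _ [-> ->].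
have gl x : g x \in slots n (size cs).
  by rewrite allpairs_f // mem_iota //= ltnS index_size.
have decE (x : K) i : i < size cs -> (x == nth x0 cs i) = (index x cs == i).
  move=> li; apply/eqP/eqP => [->|e]; first by rewrite index_uniq.
  by rewrite -e nth_index // -index_mem e.
have mem_dec o (x y : K) : ((o, x, y) \in map (decode x0 cs) ps) =
                  ((o, index x cs, index y cs) \in ps).
  elim: ps cps => //= p ps IHps /andP[/andP[c1 c2] cps].
  rewrite !inE IHps //; congr (_ || _); case: p c1 c2 => [[o' a] b] /= c1 c2.
  by rewrite !xpair_eqE !decE.
transitivity (words (relpre g (slot_compatible ps)) n (fun x =>
  g x \in slots n (size cs))).
  rewrite (@eq_words _ _ _ _ (fun x => g x \in slots n (size cs)));
    last by move=> x; rewrite gl.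
  apply: eq_words_rel => x y _ _.
  by rewrite /compatible /slot_compatible /= mem_dec.
rewrite words_lwords //; apply: eq_lwords =>
  -[v i] /allpairsP[[v' i'] [lv li [-> ->]]].
rewrite /slot_weight /=.
move: lv li {v i}; rewrite !mem_iota !add0n => lv li.
rewrite /= ltnS in lv li.
have -> : #|[pred x | g x == (v', i')]| = #|[pred c | index c cs == i']|.
  have inj : injective (fun c : K => (Ordinal lv, c)) by move=> c c' [].
  rewrite -(card_image inj); apply: eq_card => -[v c]; rewrite !inE.
  apply/idP/imageP => [|[c' + [-> ->]]].
    by rewrite xpair_eqE => /andP[/eqP e ic]; exists c; rewrite ?inE //;
      congr pair; apply: val_inj.
  by rewrite inE xpair_eqE /= eqxx.
case: ltnP => [lt_i|le_i].
  rewrite -(card1 (nth x0 cs i')); apply: eq_card => c; rewrite !inE.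
  by rewrite decE.
have -> : i' = size cs by lia.
rewrite -(card_uniqP Ucs) -(cardC (mem cs)) addKn; apply: eq_card => c.
by rewrite !inE -index_mem (card_uniqP Ucs) -leqNgt eqn_leq index_size.
Qed.

Fixpoint add_poly (u v : seq nat) : seq nat :=
  match u, v with
  | a :: u', b :: v' => a + b :: add_poly u' v'
  | [::], _ => v
  | _, [::] => u
  end.

Fixpoint eval_poly (k : nat) (u : seq nat) : nat :=
  if u is a :: u' then a + k * eval_poly k u' else 0.

(* code_count as a polynomial in k, given by its list of coefficients. *)
Fixpoint code_poly c ps n (l : seq (nat * nat)) : seq nat :=
  if n is n'.+1 then
    foldr (fun y u =>
      let v := code_poly c ps n' [seq z <- l | slot_compatible ps y z] in
      add_poly (if y.2 < c then v else 0 :: v) u) [::] l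
  else [:: 1].

Lemma eval_add_poly k u v :
  eval_poly k (add_poly u v) = eval_poly k u + eval_poly k v.
Proof.
elim: u v => [|a u IHu] [|b v] //=; first by rewrite addn0.
by rewrite IHu mulnDr addnACA.
Qed.

Lemma eval_code_poly k c ps n l :
  eval_poly k (code_poly c ps n l) =
  lwords (slot_compatible ps) (slot_weight c k) n l.
Proof.
elim: n l => [|n IHn] l /=; first by rewrite muln0.
set R := slot_compatible ps; set w := slot_weight c k.
have foldrE (s : seq (nat * nat)) : eval_poly k
   (foldr (fun y u =>
      let v := code_poly c ps n [seq z <- l | R y z] in
      add_poly (if y.2 < c then v else 0 :: v) u) [::] s) =
   \sum_(y <- s) w y * lwords R w n [seq z <- l | R y z].
  elim: s => [|y s IHs]; first by rewrite big_nil.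
  rewrite big_cons -IHs /= eval_add_poly -IHn; congr (_ + _).
  by rewrite /w /slot_weight; case: ltnP => _ //=; rewrite ?mul1n.
exact: foldrE.
Qed.

(** * Reduction of every pair to one of six representatives *)

(* 0 : no common sign; 1 : the pairs counted by two_letter_count; 2 : {+ab,+ba};
   3 : {+aa,-ab}; 4 : {+ab,+ca}; 5 : {+ab,-ac}, up to symmetry. The value is only
   meaningful for p != q. *)
Definition pair_class (K : eqType) (p q : pat K) : nat :=
  let: (o, a, b) := p in let: (o', c, d) := q in
  if [&& a != c, a != d, b != c & b != d] then 0
  else if o == o' then
    if (a == b) || (c == d) then 1
    else if (a == c) || (b == d) then 1
    else if (a == d) && (b == c) then 2 else 4
  else if (a == b) && (c == d) then 1
  else if (a == b) || (c == d) then 3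
  else if (a == c) && (b == d) || (a == d) && (b == c) then 1 else 5.

Definition class_rep (i : nat) : seq (pat nat) :=
  nth [::] [:: [:: (true, 0, 0); (true, 1, 1)]; [:: (true, 0, 0); (false, 0, 0)];
               [:: (true, 0, 1); (true, 1, 0)]; [:: (true, 0, 0); (false, 0, 1)];
               [:: (true, 0, 1); (true, 2, 0)];
               [:: (true, 0, 1); (false, 0, 2)]] i.

(** A bound for the number of signs in the representative. The common value for [i < 4] makes these
    classes polynomials in the same variable. *)
Definition class_colours (i : nat) := if i < 4 then 2 else 3.

Definition class_count i r n :=
  code_count (class_colours i) (class_rep i) (r - class_colours i) n.

Lemma pair_class_sym (K : eqType) (p q : pat K) : pair_class p q = pair_class q p.
Proof.
case: p q => [[o a] b] [[o' c] d]; rewrite /pair_class.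
rewrite [o' == o]eq_sym ![c == _]eq_sym ![d == _]eq_sym.
by case: (o == o'); case: (a == c); case: (a == d); case: (b == c);
  case: (b == d);
   case: (a == b); case: (c == d).
Qed.

Lemma pair_class_inj (K L : eqType) (f : K -> L) (p q : pat K) : injective f ->
  pair_class (p.1.1, f p.1.2, f p.2) (q.1.1, f q.1.2, f q.2) = pair_class p q.
Proof.
by move=> injf; case: p q => [[o a] b] [[o' c] d];
  rewrite /pair_class !(inj_eq injf).
Qed.

Section PairCounts.

Variables (K : finType) (n : nat).
Hypothesis K_gt1 : 1 < #|K|.
Implicit Types (p q : pat K) (a b c d : K).

Lemma avoiding_count_pair_inv (f : pat K -> pat K) p q : involutive f ->
  (forall F : pred (pat K), avoiding_count (fun x => F (f x)) n =
    avoiding_count F n) ->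
  avoiding_count (pred2 (f p) (f q)) n = avoiding_count (pred2 p q) n.
Proof.
move=> fK cntf; rewrite -cntf; apply: eq_avoiding_count => x /=.
by rewrite !(inj_eq (inv_inj fK)).
Qed.

Lemma avoiding_count_pair_flip p q :
  avoiding_count (pred2 (flip p) (flip q)) n = avoiding_count (pred2 p q) n.
Proof.
apply: avoiding_count_pair_inv => [[[o a] b]|F]; first by rewrite /flip /= negbK.
exact: avoiding_count_compl.
Qed.

(** The effect of reverse-complement on patterns; [exchange_desc] is that of the inverse. *)
Definition exchange (p : pat K) : pat K := (p.1.1, p.2, p.1.2).
Definition exchange_desc (p : pat K) : pat K := if p.1.1 then p else exchange p.

Lemma avoiding_count_pair_exchange p q :
  avoiding_count (pred2 (exchange p) (exchange q)) n = avoiding_count (pred2 p q) n.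
Proof.
by apply: avoiding_count_pair_inv => [[[o a] b]//|F]; apply: avoiding_count_rc.
Qed.

Lemma avoiding_count_pair_exchange_desc p q :
  avoiding_count (pred2 (exchange_desc p) (exchange_desc q)) n =
    avoiding_count (pred2 p q) n.
Proof.
apply: avoiding_count_pair_inv => [[[[] a] b]//|F].
by rewrite -[RHS]avoiding_count_inv; apply: eq_avoiding_count => -[[[] a] b].
Qed.

Lemma avoiding_count_pairC p q :
  avoiding_count (pred2 p q) n = avoiding_count (pred2 q p) n.
Proof. by apply: eq_avoiding_count => x; rewrite /= orbC. Qed.

Lemma avoiding_count_rep i (x0 : K) (cs : seq K) p q :
  uniq cs -> size cs = class_colours i ->
  [:: p; q] = map (decode x0 cs) (class_rep i) ->
  all (coded (class_colours i)) (class_rep i) ->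
  avoiding_count (pred2 p q) n = class_count i #|K| n.
Proof.
move=> Ucs szcs e cod; rewrite /class_count -szcs
  -(@avoiding_count_code _ _ x0) ?szcs // -e.
by apply: eq_avoiding_count => x; rewrite !inE.
Qed.

Lemma avoiding_count_rep2 a b : a != b ->
  avoiding_count (pred2 (true, a, b) (true, b, a)) n = class_count 2 #|K| n.
Proof.
by move=> ab; apply: (@avoiding_count_rep 2 a [:: a; b]); rewrite //= inE ab.
Qed.

Lemma avoiding_count_rep3 a b : a != b ->
  avoiding_count (pred2 (true, a, a) (false, a, b)) n = class_count 3 #|K| n.
Proof.
by move=> ab; apply: (@avoiding_count_rep 3 a [:: a; b]); rewrite //= inE ab.
Qed.

Lemma avoiding_count_rep4 a b c : a != b -> a != c -> b != c ->
  avoiding_count (pred2 (true, a, b) (true, c, a)) n = class_count 4 #|K| n.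
Proof.
by move=> ab ac bc; apply: (@avoiding_count_rep 4 a [:: a; b; c]);
  rewrite //= !inE negb_or ab ac bc.
Qed.

Lemma avoiding_count_rep5 a b c : a != b -> a != c -> b != c ->
  avoiding_count (pred2 (true, a, b) (false, a, c)) n = class_count 5 #|K| n.
Proof.
by move=> ab ac bc; apply: (@avoiding_count_rep 5 a [:: a; b; c]);
  rewrite //= !inE negb_or ab ac bc.
Qed.

Lemma exists_distinct : exists a b : K, a != b.
Proof. by have /card_gt1P[a [b [_ _ ab]]] := K_gt1; exists a, b. Qed.

Lemma class_count0 : class_count 0 #|K| n = disjoint_count n 1 #|K|.-1.
Proof.
have [a [b ab]] := exists_distinct.
rewrite -(@avoiding_count_rep 0 a [:: a; b] (true, a, a) (true, b, b)) //=
  ?inE ?ab //.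
by rewrite avoiding_count_disjoint // /disjoint_colours /= ab.
Qed.

Lemma class_count1 : class_count 1 #|K| n = two_letter_count #|K|.-1 n.
Proof.
have [a [b ab]] := exists_distinct.
rewrite -(@avoiding_count_rep 1 a [:: a; b] (true, a, a) (false, a, a)) //=
  ?inE ?ab //.
exact: avoiding_count_both_orders.
Qed.

(** Suppose a sign is shared. Two equal signs within a pattern, or a common sign at the same place
    of both, lead to [two_letter_count]; otherwise the common sign is first in one pattern and
    second in the other, which gives classes 2 and 4. *)
Lemma avoiding_count_pair_asc a b c d : (a, b) != (c, d) ->
  avoiding_count (pred2 (true, a, b) (true, c, d)) n =
  class_count (pair_class (true, a, b) (true, c, d)) #|K| n.
Proof.
rewrite xpair_eqE /pair_class eqxx => pq.
case: ifP => [disj|]; first by rewrite class_count0 avoiding_count_disjoint.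
rewrite -!negb_or => /negbFE share.
have same_source (x y z : K) : y != z ->
    avoiding_count (pred2 (true, x, y) (true, x, z)) n =
      two_letter_count #|K|.-1 n.
  by move=> yz; rewrite -avoiding_count_pair_exchange /exchange
    /= avoiding_count_same_target.
have diag (x y z : K) : (x, x) != (y, z) -> [|| x == y | x == z] ->
   avoiding_count (pred2 (true, x, x) (true, y, z)) n = class_count 1 #|K| n.
  rewrite class_count1 xpair_eqE; case: (eqVneq x y) => [<-|xy] /=.
    by move=> xz _; apply: same_source.
  by move=> _ /eqP<-; apply: avoiding_count_same_target.
case: (eqVneq a b) => [eab|ab] /=.
  move: share pq; rewrite -eab => share pq; apply: diag; rewrite ?xpair_eqE //.
  by move: share; case: (a == c); case: (a == d).
case: (eqVneq c d) => [ecd|cd] /=.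
  rewrite avoiding_count_pairC; move: share pq; rewrite -ecd => share pq.
  apply: diag; rewrite ?xpair_eqE 1?[c == a]eq_sym 1?[c == b]eq_sym //.
  by move: share; case: (a == c); case: (b == c).
case: (eqVneq a c) => [eac|ac] /=.
  by move: pq; rewrite -eac eqxx class_count1 => bd; apply: same_source.
case: (eqVneq b d) => [ebd|bd] /=.
  by rewrite -ebd class_count1 avoiding_count_same_target.
case: (eqVneq a d) => [ead|ad] /=.
  case: (eqVneq b c) => [ebc|bc]; first by rewrite -ead -ebc avoiding_count_rep2.
  by rewrite -ead avoiding_count_rep4.
move: share; rewrite (negPf ac) (negPf ad) (negPf bd) orbF /= => /eqP ebc.
by rewrite avoiding_count_pairC -ebc avoiding_count_rep4 // eq_sym.
Qed.

(** The inverse exchanges the signs of the 21-pattern only, [exchange] those of both, so a shared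
    sign can be moved to the first place of each pattern. *)
Lemma avoiding_count_pair_mixed a b c d :
  avoiding_count (pred2 (true, a, b) (false, c, d)) n =
  class_count (pair_class (true, a, b) (false, c, d)) #|K| n.
Proof.
rewrite /pair_class /=.
case: ifP => [disj|]; first by rewrite class_count0 avoiding_count_disjoint.
rewrite -!negb_or => /negbFE share.
have diag (x y z : K) : y != z -> (x == y) || (x == z) ->
    avoiding_count (pred2 (true, x, x) (false, y, z)) n = class_count 3 #|K| n.
  move=> yz /orP[]/eqP->; first exact: avoiding_count_rep3.
  by rewrite -avoiding_count_pair_exchange_desc /exchange_desc /exchange
    /= avoiding_count_rep3 // eq_sym.
case: (eqVneq a b) => [eab|ab] /=.
  move: share; rewrite -eab => share; case: (eqVneq c d) => [ecd|cd] /=.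
    move: share; rewrite -ecd !orbb => /eqP<-.
    by rewrite class_count1 avoiding_count_both_orders.
  by apply: diag => //; move: share; case: (a == c); case: (a == d).
case: (eqVneq c d) => [ecd|cd] /=.
  (* The complement gives the pattern with equal signs the orientation 12 that [diag] requires. *)
  rewrite -avoiding_count_pair_flip avoiding_count_pairC /flip /= -ecd;
    apply: diag => //.
  move: share; rewrite -ecd ![_ == c]eq_sym.
  by case: (c == a); case: (c == b).
have both (x y : K) : avoiding_count (pred2 (true, x, y) (false, x, y)) n =
  class_count 1 #|K| n.
  by rewrite class_count1 avoiding_count_both_orders.
case: (eqVneq a c) => [eac|ac] /=.
  rewrite -eac in cd share *; case: (eqVneq b d) => [ebd|bd] /=;
    first by rewrite -ebd both.
  by rewrite [b == a]eq_sym (negPf ab) andbF avoiding_count_rep5.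
case: (eqVneq a d) => [ead|ad] /=.
  rewrite -avoiding_count_pair_exchange_desc /exchange_desc /exchange /= -ead.
  case: (eqVneq b c) => [ebc|bc] /=; first by rewrite -ebc both.
  by rewrite avoiding_count_rep5.
move: share; rewrite (negPf ac) (negPf ad) /=.
case: (eqVneq b c) => [ebc _|bc /= /eqP ebd].
  rewrite -ebc in cd *.
  rewrite -avoiding_count_pair_exchange_desc
    -avoiding_count_pair_exchange /exchange_desc /exchange /=.
  by rewrite avoiding_count_rep5 // eq_sym.
rewrite -ebd in ad *; rewrite -avoiding_count_pair_exchange /exchange /=.
by rewrite avoiding_count_rep5 // eq_sym.
Qed.

Lemma avoiding_count_pair p q : p != q ->
  avoiding_count (pred2 p q) n = class_count (pair_class p q) #|K| n.
Proof.
case: p q => [[o a] b] [[o' c] d] pq.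
case: o o' pq => [] [] pq.
- by apply: avoiding_count_pair_asc; move: pq; rewrite !xpair_eqE.
- exact: avoiding_count_pair_mixed.
- by rewrite avoiding_count_pairC pair_class_sym avoiding_count_pair_mixed.
- by rewrite -avoiding_count_pair_flip /flip /= avoiding_count_pair_asc;
  move: pq; rewrite !xpair_eqE.
Qed.

End PairCounts.

(** * Separation of the six classes at lengths 3 and 4 *)

(** The four polynomials in the number [k] of further signs differ in the constant term only; the
    list holds the excess over class 0. *)
Lemma class_count_signature2 i k : i < 4 ->
  class_count i (k + 2) 3 =
  6 * k ^ 3 + 36 * k ^ 2 + 54 * k + 20 + nth 0 [:: 0; 4; 2; 3] i.
Proof.
case: i => [|[|[|[|//]]]] _; rewrite /class_count /code_count -eval_code_poly;
  rewrite [class_colours _]/= addnK.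
all: set u := code_poly _ _ _ _.
- have -> : u = [:: 20; 54; 36; 6] by vm_compute.
  rewrite /=; nia.
- have -> : u = [:: 24; 54; 36; 6] by vm_compute.
  rewrite /=; nia.
- have -> : u = [:: 22; 54; 36; 6] by vm_compute.
  rewrite /=; nia.
- have -> : u = [:: 23; 54; 36; 6] by vm_compute.
  rewrite /=; nia.
Qed.

(** For classes below 4, replace [k] by [k.+1] in the previous formula. Classes 2 and 5 tie here;
    [class_count_2_5] separates them. *)
Lemma class_count_signature3 i k : i < 6 ->
  class_count i (k + 3) 3 =
  6 * k ^ 3 + 54 * k ^ 2 + 144 * k + 116 + nth 0 [:: 0; 4; 2; 3; 1; 2] i.
Proof.
case: (ltnP i 4) => [lt_i4 _|].
  have -> : k + 3 = k.+1 + 2 by lia.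
  rewrite class_count_signature2 //.
  by case: i lt_i4 => [|[|[|[|//]]]] _; rewrite /=; nia.
case: i => [|[|[|[|[|[|//]]]]]] // _ _;
  rewrite /class_count /code_count -eval_code_poly [class_colours _]/= addnK.
all: set u := code_poly _ _ _ _.
- have -> : u = [:: 117; 144; 54; 6] by vm_compute.
  rewrite /=; nia.
- have -> : u = [:: 118; 144; 54; 6] by vm_compute.
  rewrite /=; nia.
Qed.

Lemma class_count_2_5 k : class_count 5 (k + 3) 4 = class_count 2 (k + 3) 4 + 2.
Proof.
rewrite /class_count /code_count
  -!eval_code_poly [class_colours 5]/= [class_colours 2]/=.
set u := code_poly 3 _ _ _; set v := code_poly 2 _ _ _.
have -> : u = [:: 1096; 1888; 1152; 288; 24] by vm_compute.
have -> : v = [:: 94; 352; 432; 192; 24] by vm_compute.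
have -> : k + 3 - 3 = k by lia.
(* Class 2 has one single sign fewer than class 5, so the variable of [v] is [k.+1]. *)
have -> : k + 3 - 2 = k.+1 by lia.
rewrite /=; nia.
Qed.

Lemma class_count_inj2 d i j : 2 <= d -> i < 4 -> j < 4 ->
  class_count i d 3 = class_count j d 3 -> i = j.
Proof.
move=> d2 li lj; have -> : d = d - 2 + 2 by lia.
rewrite !class_count_signature2 // => /addnI.
by case: i li j lj => [|[|[|[|//]]]] _ [|[|[|[|//]]]] _.
Qed.

Lemma class_count_inj3 d i j : 3 <= d -> i < 6 -> j < 6 ->
  class_count i d 3 = class_count j d 3 ->
  class_count i d 4 = class_count j d 4 -> i = j.
Proof.
move=> d3 li lj; have -> : d = d - 3 + 3 by lia.
rewrite !class_count_signature3 // => /addnI sig3.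
pose F k := class_count k (d - 3 + 3) 4; rewrite -/(F i) -/(F j).
have : F 5 = F 2 + 2 := class_count_2_5 (d - 3).
move: F => F; case: i li j lj sig3 =>
  [|[|[|[|[|[|//]]]]]] _ [|[|[|[|[|[|//]]]]]] _ //= _; lia.
Qed.

(** * The classes of two-element sets *)

(** The classes are the nonempty fibres of [f] on [D], and [s] lists their values without
    repetition. *)
Lemma card_equivalence_partition (T : finType) (R : rel T) (D : {set T})
    (f : T -> nat) (s : seq nat) :
  uniq s -> {in D &, forall x y, R x y = (f x == f y)} ->
  {in D, forall x, f x \in s} -> {in s, forall k, exists2 x, x \in D & f x = k} ->
  #|equivalence_partition R D| = size s.
Proof.
move=> Us Rf fs sf; pose g k := [set y in D | f y == k].
have Ugs : uniq (map g s).
  rewrite map_inj_in_uniq // => k k' sk _ e.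
  have [x Dx fx] := sf k sk; have : x \in g k by rewrite inE Dx fx eqxx.
  by rewrite e inE fx => /andP[_ /eqP].
rewrite -(size_map g) -(card_uniqP Ugs); apply: eq_card => A.
have gE x : x \in D -> g (f x) = [set y in D | R x y].
  by move=> Dx; apply/setP => y; rewrite !inE; case Dy: (y \in D);
    rewrite //= Rf // eq_sym.
apply/imsetP/mapP => [[x Dx ->]|[k sk ->]].
  by exists (f x); rewrite ?fs // gE.
by have [x Dx fx] := sf k sk; exists x; rewrite // -gE // fx.
Qed.

(** * Translation between the original definitions and patterns *)

Lemma forall_ord2 (P : pred 'I_2) : [forall j, P j] = P ord0 && P ord_max.
Proof.
apply/forallP/andP => [//|[P0 P1] j].
by case: j => [[|[|//]]] lj; [move: P0|move: P1]; congr (is_true (P _));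
  apply: val_inj.
Qed.

Definition pat_of r (t : signed_perm r 2) : pat 'I_r :=
  (symbols t ord0 < symbols t ord_max, signs t ord0, signs t ord_max).

Arguments pat_of {r} t.

Lemma avoidsE r n (s : signed_perm r n) (t : signed_perm r 2) :
  avoids s t = avoids_all (pred1 (pat_of t)) s.
Proof.
have occ i : occurrence t s i = (i ord0 < i ord_max) &&
   ((s.1 (i ord0) < s.1 (i ord_max), s.2 (i ord0), s.2 (i ord_max)) == pat_of t).
  rewrite /occurrence !forall_ord2 /= !ltnn !eqxx /= !andbT /symbols /signs.
  case: (ltnP (i ord0) (i ord_max)) => //= lt_i.
  rewrite (perm_lt_neg s.1 lt_i)
    (@perm_lt_neg _ t.1 ord0 ord_max) // eqb_negLR negbK.
  by rewrite andbb /pat_of !xpair_eqE -!andbA.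
apply/existsPn/avoids_allP => [H a b ab|H i].
  have := H [ffun k => if k == ord0 then a else b].
  by rewrite occ !ffunE /= ab.
by rewrite occ; apply/negP => /andP[/H/negP].
Qed.

Lemma card_avoiders r n (T : {set signed_perm r 2}) :
  #|avoiders n T| = avoiding_count (mem (pat_of @: T : {set pat 'I_r})) n.
Proof.
apply: eq_card => s; rewrite !inE;
  apply/forall_inP/avoids_allP => [H i j ij|H t Tt].
  apply/negP => /imsetP[t Tt e].
  by have := H t Tt; rewrite avoidsE => /avoids_allP/(_ i j ij);
    rewrite /= e eqxx.
rewrite avoidsE; apply/avoids_allP => i j ij; apply: contra (H i j ij) => /eqP->.
exact: imset_f.
Qed.

Lemma pat_of_inj r : injective (@pat_of r).
Proof.
have ord2 (i : 'I_2) : i = ord0 \/ i = ord_max.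
  by case: i => [[|[|//]]] lj; [left|right]; apply: val_inj.
move=> [s c] [s' c']; rewrite /pat_of /symbols /signs /= => -[es e0 e1].
have val_u (u : 'S_2) : ((u ord0 : nat) = ~~ (u ord0 < u ord_max)) /\
                        ((u ord_max : nat) = (u ord0 < u ord_max)).
  have u01 : u ord0 != u ord_max by rewrite (inj_eq perm_inj).
  by case: (ord2 (u ord0)) u01 => ->; case: (ord2 (u ord_max)) => ->.
have [s0 s1] := val_u s; have [s'0 s'1] := val_u s'.
have -> : c = c' by apply/ffunP => i; case: (ord2 i) => ->.
suff -> : s = s' by [].
apply/permP => i; apply: val_inj.
by case: (ord2 i) => ->; [rewrite [LHS]s0 es -s'0 | rewrite [LHS]s1 es -s'1].
Qed.

Definition of_pat r (p : pat 'I_r) : signed_perm r 2 :=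
  (if p.1.1 then 1%g else tperm ord0 ord_max,
   [ffun j => if j == ord0 then p.1.2 else p.2]).

Lemma of_patK r : cancel (@of_pat r) (@pat_of r).
Proof.
move=> [[o a] b]; rewrite /pat_of /of_pat /symbols /signs /= !ffunE /=.
by case: o; rewrite ?perm1 ?tpermL ?tpermR.
Qed.

Lemma pat_of_widen d r (le_dr : d <= r) (t : signed_perm d 2) :
  pat_of (widen_signs le_dr t) =
  ((pat_of t).1.1, widen_ord le_dr (pat_of t).1.2, widen_ord le_dr (pat_of t).2).
Proof. by rewrite /pat_of /widen_signs /symbols /signs /= !ffunE. Qed.

(** [enum T] lists the two elements in an unspecified order, harmless because [pair_class] is
    symmetric. For other sizes 0 is a default. *)
Definition set_class d (T : {set signed_perm d 2}) : nat :=
  if enum T is [:: t1; t2] then pair_class (pat_of t1) (pat_of t2) else 0.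

Lemma set_class2 d (t1 t2 : signed_perm d 2) : t1 != t2 ->
  set_class [set t1; t2] = pair_class (pat_of t1) (pat_of t2).
Proof.
move=> t12; rewrite /set_class.
have : perm_eq (enum [set t1; t2]) [:: t1; t2].
  by apply: uniq_perm; rewrite ?enum_uniq //= ?inE ?t12 // => t;
    rewrite mem_enum !inE.
case: (enum _) => [|x [|y [|z e]]] /[dup] /perm_size // _.
move=> /[dup] /perm_mem mem_e /perm_uniq; rewrite /= !inE t12 !andbT => xy.
have : x \in [:: t1; t2] by rewrite -mem_e mem_head.
have : y \in [:: t1; t2] by rewrite -mem_e !inE eqxx orbT.
move: xy; rewrite !inE => xy /orP[]/eqP yE /orP[]/eqP xE; move: xy;
  rewrite xE yE ?eqxx // => _ //.
exact: (pair_class_sym (pat_of t2) (pat_of t1)).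
Qed.

(** Apart from the orientations, [pair_class] depends only on which signs coincide, so it survives
    the injective widening of signs. *)
Lemma card_avoiders_pair d r n (le_dr : d <= r) (T : {set signed_perm d 2}) :
  2 <= d -> #|T| == 2 ->
  #|avoiders n (widen_signs le_dr (k:=2) @: T)| = class_count (set_class T) r n.
Proof.
move=> d2 /cards2P[t1 [t2 [t12 ->]]].
have injw : injective (widen_ord le_dr) by move=> i j /(congr1 val) /= /val_inj.
rewrite set_class2 // card_avoiders imsetU1 imset_set1 imsetU1 imset_set1.
rewrite -(pair_class_inj _ _ injw) -!pat_of_widen.
set p1 := pat_of (widen_signs _ _); set p2 := pat_of (widen_signs _ _).
rewrite (@eq_avoiding_count _ _ _ (pred2 p1 p2)) => [|x]; last by rewrite !inE.
rewrite avoiding_count_pair ?card_ord //; first exact: leq_trans d2 le_dr.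
rewrite /p1 /p2 !pat_of_widen;
  apply: contraNneq t12 => -[e0 /val_inj e1 /val_inj e2].
by apply/eqP/pat_of_inj; rewrite /pat_of e0 e1 e2.
Qed.

(** The class number determines the counts for every [r]; conversely the counts with [r = d] recover
    it. The list [s] holds the class numbers that occur over [d] signs. *)
Lemma card_wilf_classes d (s : seq nat) : 2 <= d -> uniq s ->
  (forall i j, i \in s -> j \in s ->
     (forall n, class_count i d n = class_count j d n) -> i = j) ->
  (forall p q : pat 'I_d, p != q -> pair_class p q \in s) ->
  {in s, forall k, exists p q : pat 'I_d, p != q /\ pair_class p q = k} ->
  #|wilf_classes_of_pairs d| = size s.
Proof.
move=> d2 Us inj_s cls_s s_cls.
have set_s : {in [set T : {set signed_perm d 2} | #|T| == 2],
              forall T, set_class T \in s}.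
  move=> T; rewrite inE => /cards2P[t1 [t2 [t12 ->]]]; rewrite set_class2 //.
  by apply: cls_s; rewrite (inj_eq (@pat_of_inj d)).
apply: (@card_equivalence_partition _ _ _ (@set_class d)) => //.
- move=> T1 T2 D1 D2; have [c1 c2] : #|T1| == 2
  /\ #|T2| == 2 by rewrite !inE in D1 D2.
  apply/asboolP/eqP => [W|e n r le_dr]; last by rewrite !card_avoiders_pair ?e.
  apply: inj_s; rewrite ?set_s // => n.
  by rewrite -!(card_avoiders_pair n (leqnn d)) // W.
- move=> k /s_cls[p [q [pq <-]]]; exists [set of_pat p; of_pat q].
    by rewrite inE cards2 (can_eq (@of_patK d)) pq.
  by rewrite set_class2 ?(can_eq (@of_patK d)) // !of_patK.
Qed.

Theorem mainTheorem1 :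
  (forall (r : nat) (t : signed_perm r 2) (n : nat), 1 <= r ->
     #|avoiders n [set t]| =
       \sum_(0 <= j < n.+1) j`! * (r - 1) ^ j * 'C(n, j) ^ 2)
  /\
  [/\ #|wilf_classes_of_pairs 1| = 1,
      #|wilf_classes_of_pairs 2| = 4
    & forall d : nat, 3 <= d -> #|wilf_classes_of_pairs d| = 6].
Proof.
split=> [r t n _|].
  rewrite card_avoiders imset_set1 (@eq_avoiding_count _ _ _ (pred1
    (pat_of t))); last first.
    by move=> p; rewrite !inE.
  by rewrite avoiding_count_pred1 card_ord -subn1.
split.
(* With one sign there are two patterns, hence a single two-element set. *)
- have card1_2 : #|[set: signed_perm 1 2]| = 2.
    by rewrite cardsT card_prod card_Sn card_ffun !card_ord.
  apply: (@card_equivalence_partition _ _ _ (fun=> 0) [:: 0]) => // [T1 T2|k].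
    have full (T : {set signed_perm 1 2}) : #|T| == 2 -> T = setT.
      by move=> /eqP cT; apply/eqP; rewrite eqEcard subsetT cT card1_2.
    rewrite !inE => /full-> /full->; exact/asboolP.
  by rewrite inE => /eqP->; exists setT; rewrite // inE card1_2.
(* Classes 4 and 5 involve three distinct signs and do not occur over two signs. *)
- apply: (@card_wilf_classes 2 [:: 0; 1; 2; 3]) => //.
  + move=> i j si sj e; apply: (@class_count_inj2 2) => //.
      by move: si; rewrite !inE; lia.
    by move: sj; rewrite !inE; lia.
  + move=> [[o a] b] [[o' c] e] _; move: o o' a b c e.
    do 2![case]; do 4![case=> [[|[|//]] ?]]; by vm_compute.
  + pose c0 : 'I_2 := ord0; pose c1 : 'I_2 := ord_max.
    move=> k; rewrite !inE => /or4P[]/eqP->.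
    * by exists (true, c0, c0), (true, c1, c1).
    * by exists (true, c0, c0), (false, c0, c0).
    * by exists (true, c0, c1), (true, c1, c0).
    * by exists (true, c0, c0), (false, c0, c1).
- move=> d d3; apply: (@card_wilf_classes d (iota 0 6)) => //; first exact: ltnW.
  + move=> i j; rewrite !mem_iota => si sj e.
    exact: (class_count_inj3 d3 si sj (e 3) (e 4)).
  + move=> [[o a] b] [[o' c] e] _; rewrite /pair_class.
    by do !case: ifP.
  + pose c0 : 'I_d := Ordinal (leq_trans (isT : 0 < 3) d3).
    pose c1 : 'I_d := Ordinal (leq_trans (isT : 1 < 3) d3).
    pose c2 : 'I_d := Ordinal (leq_trans (isT : 2 < 3) d3).
    move=> k; rewrite mem_iota; case: k => [|[|[|[|[|[|//]]]]]] _.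
    * by exists (true, c0, c0), (true, c1, c1).
    * by exists (true, c0, c0), (false, c0, c0).
    * by exists (true, c0, c1), (true, c1, c0).
    * by exists (true, c0, c0), (false, c0, c1).
    * by exists (true, c0, c1), (true, c2, c0).
    * by exists (true, c0, c1), (false, c0, c2).
Qed.
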